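(* Let $\eta>0$ and let $\mathbf X^{[0]},\mathbf X^{[1]},\mathbf X^{[2]},\dots$ be the outer iterates of the rcSMACOF algorithm. At outer iteration $v$, define $q_k^{[v]}=w_k/(|r_k(\mathbf X^{[v]})|+\eta)$ for $k\in\mathcal E$. Suppose that at each outer iteration $v$ the inner Conditional SMACOF step returns $\mathbf X^{[v+1]}$ satisfying $$\sum_{k\in\mathcal E} q_k^{[v]}\,r_k(\mathbf X^{[v+1]})^2\le\sum_{k\in\mathcal E} q_k^{[v]}\,r_k(\mathbf X^{[v]})^2 .$$ Then $0\le\sigma_\eta(\mathbf X^{[v+1]})\le\sigma_\eta(\mathbf X^{[v]})$ for every $v$; the sequence $\{\sigma_\eta(\mathbf X^{[v]})\}_v$ is monotone nonincreasing and bounded below.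
   Context: Setting: $n,p,q$ are positive integers with $n>p+q$; $\Delta=(\delta_{ij})\in[0,\infty)^{n\times n}$ is symmetric with $\delta_{ii}=0$; $\mathbf W=(w_{ij})\in[0,\infty)^{n\times n}$ is a symmetric nonnegative irreducible weight matrix (the $n$ objects cannot be partitioned into two nonempty groups with all intergroup weights zero); $\mathcal E=\{(i,j):1\le i<j\le n,\ w_{ij}>0\}$ is the active pair set; $\mathbf V\in\mathbb R^{n\times q}$ has rows $\mathbf v_1^\top,\dots,\mathbf v_n^\top$, and the differences $\mathbf v_i-\mathbf v_j$, $(i,j)\in\mathcal E$, contain $q$ linearly independent vectors. For $\mathbf X=(\mathbf U,\mathbf B)$ with $\mathbf U\in\mathbb R^{n\times p}$ (rows $\mathbf u_1^\top,\dots,\mathbf u_n^\top$) and $\mathbf B\in\mathbb R^{q\times q}$, and for $k=(i,j)\in\mathcal E$, write $\delta_k=\delta_{ij}$, $w_k=w_{ij}$, $$d_k(\mathbf X)=\sqrt{\|\mathbf u_i-\mathbf u_j\|_2^2+\|\mathbf B^\top(\mathbf v_i-\mathbf v_j)\|_2^2},\qquad r_k(\mathbf X)=\delta_k-d_k(\mathbf X).$$ The rcMDS objective is $\sigma_\eta(\mathbf X)=\sum_{k\in\mathcal E}w_k\,\rho_\eta(r_k(\mathbf X))$, where $\rho_\eta(t)=|t|-\eta\ln(1+|t|/\eta)$. rcSMACOF: start from an arbitrary $\mathbf X^{[0]}=(\mathbf U^{[0]},\mathbf B^{[0]})$. At outer iteration $v$, compute the weights $q_k^{[v]}=w_k/(|r_k(\mathbf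 X^{[v]})|+\eta)$ for $k\in\mathcal E$ (extended symmetrically in $i,j$, with $q_{ij}^{[v]}=0$ if $w_{ij}=0$), hold them fixed, and run finitely many inner Conditional SMACOF updates started from $\mathbf U^{[v,0]}=\mathbf U^{[v]}$, $\mathbf B^{[v,0]}=\mathbf B^{[v]}$: $$\mathbf U^{[v,w+1]}=(\mathbf H^{[v]})^+\mathbf C^{[v,w]}\mathbf U^{[v,w]},\qquad \mathbf B^{[v,w+1]}=(\mathbf V^\top\mathbf H^{[v]}\mathbf V)^+\mathbf V^\top\mathbf C^{[v,w]}\mathbf V\mathbf B^{[v,w]},$$ where $(\cdot)^+$ is the Moore–Penrose inverse, $\mathbf H^{[v]}$ has off-diagonal entries $-q_{ij}^{[v]}$ and diagonal entries $\sum_{l\ne i}q_{il}^{[v]}$, and $\mathbf C^{[v,w]}$ has off-diagonal entries $-q_{ij}^{[v]}\delta_{ij}/d_{ij}(\mathbf U^{[v,w]},\mathbf B^{[v,w]})$ if $d_{ij}(\mathbf U^{[v,w]},\mathbf B^{[v,w]})\ne0$ and $0$ otherwise, and diagonal entries $c_{ii}^{[v,w]}=-\sum_{j\ne i}c_{ij}^{[v,w]}$. The final inner iterate is $\mathbf X^{[v+1]}=(\mathbf U^{[v+1]},\mathbf B^{[v+1]})$. *)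

(* Defs.v *)
From mathcomp Require Import all_boot all_order all_algebra.
From mathcomp Require Import all_classical all_reals all_analysis.

Set Implicit Arguments.
Unset Strict Implicit.
Unset Printing Implicit Defensive.

Import Order.TTheory GRing.Theory Num.Theory.

Local Open Scope ring_scope.

(* The norm `|_| on matrices is the maximum norm, hence this definition. *)
Definition l2norm (R : realType) (m : nat) (x : 'cV[R]_m) : R :=
  Num.sqrt (\sum_i x i 0 ^+ 2).

(* The i-th row, transposed to a column vector. *)
Definition rowv (R : realType) (m n : nat) (A : 'M[R]_(m, n)) (i : 'I_m) :
  'cV[R]_n := (row i A)^T.

Definition is_pinv (R : realType) (m n : nat)
    (A : 'M[R]_(m, n)) (X : 'M[R]_(n, m)) : Prop :=
  [/\ A *m X *m A = A,
      X *m A *m X = X,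
      (A *m X)^T = A *m X
    & (X *m A)^T = X *m A].

(* pinvP and is_pinv_uniq below show that the default value 0 is never used
   and that the choice is unique. *)
Definition pinv (R : realType) (m n : nat) (A : 'M[R]_(m, n)) :
  'M[R]_(n, m) := xget 0 [set X | is_pinv A X]%classic.

Lemma is_pinv_uniq (R : realType) (m n : nat) (A : 'M[R]_(m, n))
    (X Y : 'M[R]_(n, m)) : is_pinv A X -> is_pinv A Y -> X = Y.
Proof.
move=> [X1 X2 X3 X4] [Y1 Y2 Y3 Y4].
have AXY : A *m X = A *m Y.
  rewrite -X3 -{1}Y1 -mulmxA trmx_mul X3 Y3.
  by rewrite mulmxA X1.
have XAY : X *m A = Y *m A.
  rewrite -X4 -{1}Y1 -mulmxA [X *m _]mulmxA trmx_mul X4 Y4.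
  by rewrite -mulmxA [A *m (X *m A)]mulmxA X1.
by rewrite -X2 XAY -mulmxA AXY mulmxA Y2.
Qed.

Lemma row_free_gram (R : realType) (m n : nat) (A : 'M[R]_(m, n)) :
  row_free A -> A *m A^T \in unitmx.
Proof.
move=> fA; rewrite -row_free_unit; apply/row_freeP.
suff /eqP k0 : kermx (A *m A^T) == 0.
  have /row_freeP[B BE] : row_free (A *m A^T) by rewrite -kermx_eq0 k0.
  by exists B.
apply/eqP/row_matrixP => i; rewrite row0.
set x := row i _.
have xG : x *m (A *m A^T) = 0.
  by apply/eqP; rewrite -sub_kermx row_sub.
have xA : x *m A = 0.
  set y := x *m A.
  have : y *m y^T = 0 by rewrite /y trmx_mul mulmxA -(mulmxA x) xG mul0mx.
  move=> /matrixP/(_ 0 0); rewrite [LHS]mxE [RHS]mxE => y0.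
  have yE j : y 0 j = 0.
    apply/eqP; rewrite -sqrf_eq0.
    have yy l : y 0 l * y^T l 0 = y 0 l ^+ 2 by rewrite [y^T _ _]mxE expr2.
    have /psumr_eq0P h : forall l, true -> 0 <= y 0 l * y^T l 0.
      by move=> l _; rewrite yy sqr_ge0.
    by rewrite -yy (h y0 j).
  by apply/matrixP => a j; rewrite (ord1 a) yE mxE.
by apply: (row_free_inj fA); rewrite xA mul0mx.
Qed.

Lemma pinvP (R : realType) (m n : nat) (A : 'M[R]_(m, n)) :
  is_pinv A (pinv A).
Proof.
apply: (@xgetPex _ 0 [set X | is_pinv A X]%classic) => /=.
have [r [L [P [AE PU LU]]]] : exists r (L : 'M[R]_(m, r)) (P : 'M[R]_(r, n)),
    [/\ A = L *m P, P *m P^T \in unitmx & L^T *m L \in unitmx].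
  exists (\rank A), (col_base A), (row_base A); split.
  - by rewrite mulmx_base.
  - by apply: row_free_gram; exact: row_base_free.
  - rewrite -{2}(trmxK (col_base A)); apply: row_free_gram.
    by rewrite /row_free mxrank_tr; have := col_base_full A; rewrite /row_full.
exists (P^T *m invmx (P *m P^T) *m (invmx (L^T *m L) *m L^T)).
set GP := invmx (P *m P^T); set GL := invmx (L^T *m L).
have GPt : GP^T = GP by rewrite /GP trmx_inv trmx_mul trmxK.
have GLt : GL^T = GL by rewrite /GL trmx_inv trmx_mul trmxK.
have AX : A *m (P^T *m GP *m (GL *m L^T)) = L *m GL *m L^T.
  rewrite {1}AE -!mulmxA (mulmxA P) (mulmxA (P *m P^T)) mulmxV //.
  by rewrite mul1mx.
have XA : (P^T *m GP *m (GL *m L^T)) *m A = P^T *m GP *m P.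
  rewrite {1}AE -!mulmxA (mulmxA L^T) (mulmxA GL) mulVmx //.
  by rewrite mul1mx.
split.
- rewrite AX {1}AE -!mulmxA (mulmxA L^T) (mulmxA GL) mulVmx // mul1mx.
  by rewrite -AE.
- rewrite XA -!mulmxA (mulmxA P) (mulmxA GP (P *m P^T)) mulVmx //.
  by rewrite mul1mx.
- by rewrite AX !trmx_mul trmxK GLt mulmxA.
- by rewrite XA !trmx_mul trmxK GPt mulmxA.
Qed.

Definition irreducible_weights (R : realType) (n : nat) (W : 'M[R]_n) : Prop :=
  ~ exists S : {set 'I_n},
      [/\ S != finset.set0, ~: S != finset.set0
        & forall i j : 'I_n, i \in S -> j \in ~: S -> W i j = 0].

Definition active (R : realType) (n : nat) (W : 'M[R]_n) :
  {set 'I_n * 'I_n} := [set k : 'I_n * 'I_n | (k.1 < k.2)%N && (0 < W k.1 k.2)].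

Definition has_indep_differences (R : realType) (n q : nat)
    (W : 'M[R]_n) (V : 'M[R]_(n, q)) : Prop :=
  exists k : 'I_q -> 'I_n * 'I_n,
    (forall a, k a \in active W) /\
    row_free (\matrix_(a < q) (row (k a).1 V - row (k a).2 V)).

Section RcMDS.
Context (R : realType) (n p q : nat).
Implicit Types (Delta W : 'M[R]_n) (V : 'M[R]_(n, q)) (k : 'I_n * 'I_n).
Implicit Types (X : 'M[R]_(n, p) * 'M[R]_q) (eta : R).

Definition dist V X k : R :=
  Num.sqrt (l2norm (rowv X.1 k.1 - rowv X.1 k.2) ^+ 2 +
            l2norm (X.2^T *m (rowv V k.1 - rowv V k.2)) ^+ 2).

Definition resid Delta V X k : R := Delta k.1 k.2 - dist V X k.

Definition rho eta (t : R) : R := `|t| - eta * ln (1 + `|t| / eta).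

Definition sigma Delta W V eta X : R :=
  \sum_(k in active W) W k.1 k.2 * rho eta (resid Delta V X k).

(* Evaluated at all (i, j), not only at active pairs: for symmetric Delta and W
   this is the symmetric extension, and it vanishes where W does. *)
Definition qweight Delta W V eta X k : R :=
  W k.1 k.2 / (`|resid Delta V X k| + eta).

Definition laplacian (a : 'I_n * 'I_n -> R) : 'M[R]_n :=
  \matrix_(i, j) (if i == j then \sum_(l | l != i) a (i, l) else - a (i, j)).

Definition Hmx (Q : 'I_n * 'I_n -> R) : 'M[R]_n := laplacian Q.

Definition Cmx Delta V (Q : 'I_n * 'I_n -> R) X : 'M[R]_n :=
  laplacian (fun k =>
    if dist V X k != 0 then Q k * Delta k.1 k.2 / dist V X k else 0).

Definition inner_step Delta V (Q : 'I_n * 'I_n -> R) X :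
    'M[R]_(n, p) * 'M[R]_q :=
  (pinv (Hmx Q) *m Cmx Delta V Q X *m X.1,
   pinv (V^T *m Hmx Q *m V) *m V^T *m Cmx Delta V Q X *m V *m X.2).

(* N v is the number of inner updates performed at outer iteration v. *)
Definition rcSMACOF_iterates Delta W V eta
    (X : nat -> 'M[R]_(n, p) * 'M[R]_q) : Prop :=
  exists N : nat -> nat, forall v : nat,
    X v.+1 = iter (N v) (inner_step Delta V (qweight Delta W V eta (X v))) (X v).

End RcMDS.

(* Main.v *)
(** [rho eta] is a concave function of [t ^+ 2], so it lies below its tangent in
    that variable at [s ^+ 2], whose slope is [(2 * (`|s| + eta))^-1]. Weighting
    by [W] and summing over the active pairs, the decrease of [sigma] in one outer
    iteration is at least half the decrease of the inner weighted least-squares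
    objective. *)
Require Import Defs.
From mathcomp Require Import all_boot all_order all_algebra.
From mathcomp Require Import all_classical all_reals all_analysis.
From mathcomp Require Import ring lra.
Import Order.TTheory GRing.Theory Num.Theory.
Import numFieldNormedType.Exports.
Local Open Scope ring_scope.

(** This is [ln (1 + x) <= x] at [x = |t| / eta], scaled by [eta]. *)
Lemma rho_ge0 {R : realType} (eta t : R) : 0 < eta -> 0 <= rho eta t.
Proof.
move=> eta_gt0; rewrite subr_ge0 -ler_pdivlMl // [eta^-1 * _]mulrC le_ln1Dx //.
by apply: (lt_le_trans (ltrN10 R)); rewrite divr_ge0 // ltW.
Qed.

(** With [x = |t|] and [b = |s|], this is the tangent majorizer of [rho eta] at [s] minus [rho eta]
    itself, up to an additive constant depending only on [b] and [eta]. *)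
Definition tangent_gap {R : realType} (eta b x : R) : R :=
  (2 * (b + eta))^-1 * x ^+ 2 - (x - eta * ln (1 + eta^-1 * x)).

(** The two parts have derivatives [x / (b + eta)] and [x / (x + eta)]; the common denominator
    exposes the factor [x - b], which decides the sign for [x > 0]. *)
Lemma is_derive_tangent_gap {R : realType} (eta b x : R) :
    0 < eta -> 0 <= b -> 0 <= x ->
  is_derive x 1 (tangent_gap eta b) (x * (x - b) / ((b + eta) * (x + eta))).
Proof.
move=> eta_gt0 b_ge0 x_ge0.
have u_gt0 : 0 < 1 + eta^-1 * x.
  by rewrite ltr_pwDl // mulr_ge0 // invr_ge0 ltW.
have du : is_derive x (1 : R) (fun y : R => 1 + eta^-1 * y) eta^-1.
  have := is_deriveD (is_derive_cst (1 : R) x (1 : R))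
    (is_deriveZ eta^-1 (is_derive_id x (1 : R))).
  by rewrite add0r /GRing.scale /= mulr1.
have dln := @is_derive1_comp _ (@ln R) (fun y => 1 + eta^-1 * y) _ _ _
  (is_derive1_ln u_gt0) du.
have did := is_derive_id x (1 : R).
have := is_deriveB (is_deriveZ (2 * (b + eta))^-1 (is_deriveX 2 did))
  (is_deriveB did (is_deriveZ eta dln)).
move=> /is_derive_eq; apply; rewrite /GRing.scale /=.
by field; do ?[apply/andP; split]; lra.
Qed.

(** By the sign of its derivative, the gap decreases on [[0, b]] and increases beyond [b]. *)
Lemma tangent_gap_min {R : realType} (eta b a : R) :
  0 < eta -> 0 <= b -> 0 <= a -> tangent_gap eta b b <= tangent_gap eta b a.
Proof.
move=> eta_gt0 b_ge0 a_ge0.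
(* The condition [0 <= c] keeps the interval inside the half-line where the derivative formula
   holds. Both cases below take [b] as one endpoint. *)
have mvt (c d : R) : 0 <= c -> c < d -> exists2 x : R, c < x < d &
    tangent_gap eta b d - tangent_gap eta b c =
    x * (x - b) / ((b + eta) * (x + eta)) * (d - c).
  move=> c_ge0 cd; case: (@MVT _ (tangent_gap eta b)
    (fun x => x * (x - b) / ((b + eta) * (x + eta))) c d cd).
  - move=> x /[!in_itv]/= /andP[cx _].
    by apply: is_derive_tangent_gap => //; lra.
  - apply: derivable_within_continuous => x /[!in_itv]/= /andP[cx _].
    have x_ge0 : 0 <= x by lra.
    by have [] := is_derive_tangent_gap _ _ _ eta_gt0 b_ge0 x_ge0.
  - by move=> x /[!in_itv]/= cxd E; exists x.
case: (ltgtP a b) => [ab|ba|-> //].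
- case: (mvt a b a_ge0 ab) => x /andP[ax xb] E.
  rewrite -subr_le0 E; apply: mulr_le0_ge0; last lra.
  apply: mulr_le0_ge0; last by rewrite invr_ge0 mulr_ge0 //; lra.
  by apply: mulr_ge0_le0; lra.
- case: (mvt b a b_ge0 ba) => x /andP[bx xa] E.
  rewrite -subr_ge0 E; apply: mulr_ge0; last lra.
  by rewrite divr_ge0 // mulr_ge0 //; lra.
Qed.

(** The gap with [b = |s|] is minimal at [|s|]; comparing its values at [|s|] and [|t|] and
    rearranging gives the tangent inequality, since squaring removes the absolute values. *)
Lemma rho_majorize {R : realType} (eta s t : R) : 0 < eta ->
  rho eta t <= rho eta s + (t ^+ 2 - s ^+ 2) / (2 * (`|s| + eta)).
Proof.
move=> eta_gt0.
have := @tangent_gap_min _ _ _ _ eta_gt0 (normr_ge0 s) (normr_ge0 t).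
rewrite /tangent_gap /rho !real_normK ?num_real // mulrBl.
rewrite ![_ / eta]mulrC ![_ / (2 * _)]mulrC; lra.
Qed.

Section SigmaDescent.
Context {R : realType} {n p q : nat}.
Variables (Delta W : 'M[R]_n) (V : 'M[R]_(n, q)) (eta : R).
Implicit Types X Y : 'M[R]_(n, p) * 'M[R]_q.

Lemma sigma_ge0 X : 0 < eta -> 0 <= sigma Delta W V eta X.
Proof.
move=> eta_gt0; apply: sumr_ge0 => k; rewrite inE => /andP[_ Wk].
by rewrite mulr_ge0 ?rho_ge0 // ltW.
Qed.

Lemma sigma_descent X Y : 0 < eta ->
    \sum_(k in active W) qweight Delta W V eta X k * resid Delta V Y k ^+ 2 <=
    \sum_(k in active W) qweight Delta W V eta X k * resid Delta V X k ^+ 2 ->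
  sigma Delta W V eta Y <= sigma Delta W V eta X.
Proof.
move=> eta_gt0; rewrite -subr_le0 -sumrB => le0.
rewrite -subr_le0 -sumrB.
(* The factor [2^-1] comes from the tangent slope: [W] times [(2 * (|s| + eta))^-1] is half of
   [qweight]. *)
apply: (@le_trans _ _ (2^-1 * \sum_(k in active W)
    (qweight Delta W V eta X k * resid Delta V Y k ^+ 2 -
     qweight Delta W V eta X k * resid Delta V X k ^+ 2))); last first.
  by rewrite mulr_ge0_le0 // invr_ge0.
rewrite mulr_sumr; apply: ler_sum => k; rewrite inE => /andP[_ Wk].
rewrite -mulrBr -mulrBr /qweight.
set s := resid _ _ X k; set t := resid _ _ Y k.
(* Active pairs have positive weight, so [W k.1 k.2] cancels and the termwise claim becomes
   [rho_majorize]. *)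
rewrite (_ : 2^-1 * _ = W k.1 k.2 * ((t ^+ 2 - s ^+ 2) / (2 * (`|s| + eta)))).
  by rewrite ler_pM2l // lerBlDl rho_majorize.
by rewrite invfM; ring.
Qed.

End SigmaDescent.

Theorem theorem3 (R : realType) (n p q : nat)
    (Delta W : 'M[R]_n) (V : 'M[R]_(n, q)) (eta : R)
    (X : nat -> 'M[R]_(n, p) * 'M[R]_q)
    (n_gt0 : (0 < n)%N) (p_gt0 : (0 < p)%N) (q_gt0 : (0 < q)%N)
    (n_gt_pq : (p + q < n)%N)
    (Delta_ge0 : forall i j, 0 <= Delta i j)
    (Delta_sym : forall i j, Delta i j = Delta j i)
    (Delta_diag : forall i, Delta i i = 0)
    (W_ge0 : forall i j, 0 <= W i j)
    (W_sym : forall i j, W i j = W j i)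
    (W_irr : irreducible_weights W)
    (V_indep : has_indep_differences W V)
    (eta_gt0 : 0 < eta)
    (X_iter : rcSMACOF_iterates Delta W V eta X)
    (X_inner : forall v : nat,
      \sum_(k in active W)
        qweight Delta W V eta (X v) k * resid Delta V (X v.+1) k ^+ 2 <=
      \sum_(k in active W)
        qweight Delta W V eta (X v) k * resid Delta V (X v) k ^+ 2) :
  [/\ forall v : nat,
        0 <= sigma Delta W V eta (X v.+1) <= sigma Delta W V eta (X v),
      nonincreasing_seq (fun v : nat => sigma Delta W V eta (X v))
    & has_lbound (range (fun v : nat => sigma Delta W V eta (X v)))].
Proof.
(* The weights of iteration [v] come from the residuals at [X v], so the tangent is taken at the
   current iterate and [X_inner] is the required hypothesis. *)
have descent v : sigma Delta W V eta (X v.+1) <= sigma Delta W V eta (X v).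
  exact/sigma_descent/X_inner.
split.
- by move=> v; rewrite sigma_ge0 //= descent.
- by apply/nonincreasing_seqP => v; exact: descent.
- by exists 0 => _ [v _ <-]; exact: sigma_ge0.
Qed.
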